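(* Let $G$ be a countably infinite (discrete) group. For every nonempty subset $H$ of $G$, the following are equivalent: (a) ($H$ is vdC) For every m.p.s. $(X,\mathscr{B},\mu,(T_g)_{g\in G})$ and every $f\in L^\infty(X,\mu)$, $$\int_X f(T_hx)\overline{f(x)}\,d\mu(x)=0\ \text{ for every }h\in H\quad\Longrightarrow\quad\int_X f\,d\mu=0.$$ (b) ($H$ is a set of operatorial recurrence) For every m.p.s. $(X,\mathscr{B},\mu,(T_g)_{g\in G})$ and every $f\in L^2(X,\mu)$, $$\int_X f(T_hx)\overline{f(x)}\,d\mu(x)=0\ \text{ for every }h\in H\quad\Longrightarrow\quad\int_X f\,d\mu=0.$$ (c) There do not exist a positive-definite function $\varphi\colon G\to\mathbb{C}$ and a real constant $r<0$ such that $\varphi(h)=r$ for every $h\in H$.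
   Context: A measure-preserving system (m.p.s.) $(X,\mathscr{B},\mu,(T_g)_{g\in G})$ consists of a standard probability space $(X,\mathscr{B},\mu)$ and a measure-preserving action $T$ of $G$ on it. Functions in $L^\infty(X,\mu)$ and $L^2(X,\mu)$ are complex-valued. A function $\varphi:G\to\mathbb{C}$ is positive definite if $\sum_{i,j=1}^n c_i\overline{c_j}\,\varphi(g_j^{-1}g_i)\geq0$ for all $n\in\mathbb{N}$, $g_1,\dots,g_n\in G$, $c_1,\dots,c_n\in\mathbb{C}$. *)

(* Defs.v *)
From mathcomp Require Export all_boot all_order all_algebra.
From mathcomp Require Export complex.
From mathcomp Require Export all_classical all_reals all_analysis.

Set Implicit Arguments.
Unset Strict Implicit.
Unset Printing Implicit Defensive.

Import Order.TTheory GRing.Theory Num.Theory.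

Local Open Scope classical_set_scope.
Local Open Scope ring_scope.
Local Open Scope complex_scope.

(* X is Borel isomorphic to a Polish space Y.  The topological structures of
   the library are pseudometric and do not include separation, hence
   [hausdorff_space]; [<<s open >>] is the Borel sigma-algebra of Y. *)
Definition standard_borel (R : realType) (d : measure_display)
    (X : measurableType d) : Prop :=
  exists Y : completePseudoMetricType R,
    [/\ hausdorff_space Y,
        @second_countable Y &
        exists2 e : Y -> X, bijective e &
          forall A : set X,
            measurable A <-> <<s @open Y >> (e @^-1` A)].

Record mps (R : realType) (G : groupType) := Mps {
  mps_display : measure_display;
  mps_space :> measurableType mps_display;
  mps_measure : probability mps_space R;
  mps_act : G -> mps_space -> mps_space;
  mps_standard : standard_borel R mps_space;
  mps_act1 : forall x, mps_act 1%g x = x;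
  mps_actM : forall g h x, mps_act (g * h)%g x = mps_act g (mps_act h x);
  mps_act_measurable : forall g, measurable_fun [set: mps_space] (mps_act g);
  mps_act_preserving : forall g (A : set mps_space), measurable A ->
    mps_measure (mps_act g @^-1` A) = mps_measure A
}.

Section complex_valued_functions.
Context (R : realType) (d : measure_display) (X : measurableType d).
Variable mu : {measure set X -> \bar R}.

(* L^p(X, mu) for complex-valued functions (as functions, not classes). *)
Definition CLfun (p : \bar R) (f : X -> R[i]) : Prop :=
  [/\ measurable_fun [set: X] (fun x => complex.Re (f x)),
      measurable_fun [set: X] (fun x => complex.Im (f x)) &
      finite_norm mu p (fun x => Normc.normc (f x))].

(* [Rintegral] is a junk value outside L^1; it is only applied below to
   functions that are integrable (f in L^2 and mu finite). *)
Definition Cintegral (f : X -> R[i]) : R[i] :=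
  Rintegral mu [set: X] (fun x => complex.Re (f x)) +i*
  Rintegral mu [set: X] (fun x => complex.Im (f x)).

End complex_valued_functions.

(* The condition common to vdC sets (p = +oo) and sets of operatorial
   recurrence (p = 2). *)
Definition recurrent_for (R : realType) (G : groupType) (p : \bar R)
    (H : set G) : Prop :=
  forall (X : mps R G) (f : X -> R[i]), CLfun (mps_measure X) p f ->
    (forall h, H h ->
      Cintegral (mps_measure X) (fun x => f (mps_act h x) * (f x)^*) = 0) ->
    Cintegral (mps_measure X) f = 0.

Definition vdC_set (R : realType) (G : groupType) (H : set G) : Prop :=
  recurrent_for (+oo%E : \bar R) H.

Definition operatorial_recurrence_set (R : realType) (G : groupType)
    (H : set G) : Prop :=
  recurrent_for (2%:E : \bar R) H.

(* In the order of R[i], [0 <= z] means that z is real and nonnegative. *)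
Definition positive_definite (R : realType) (G : groupType)
    (phi : G -> R[i]) : Prop :=
  forall (n : nat) (g : 'I_n -> G) (c : 'I_n -> R[i]),
    0 <= \sum_(i < n) \sum_(j < n) c i * (c j)^* * phi ((g j)^-1 * g i)%g.

(* Main.v *)
From HB Require Import structures.
From mathcomp Require Import ring lra measurable_realfun ess_sup_inf.
Require Import Defs.

Set Implicit Arguments.
Unset Strict Implicit.
Unset Printing Implicit Defensive.

Import Order.TTheory GRing.Theory Num.Theory.
Import numFieldNormedType.Exports.

Local Open Scope classical_set_scope.
Local Open Scope ring_scope.
Local Open Scope complex_scope.

(* For (c) => (a), (b): if the correlations of f vanish on H, then the
   autocorrelation of f - m, where m is the integral of f, is positive definite
   and equal to - |m|^2 on H.

   For the converse, let phi be positive definite and equal to r < 0 on H.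
   Heuristically, take a centred Gaussian process X on G with covariance
   Re phi(b^-1 a) and, given X, independent signs eps_g with mean sin X_g.
   The joint law of eps_1 and eps_h depends only on phi(1) and r when h is in H,
   and its covariance is rho = exp(- phi(1)) sinh r < 0; hence
   eps_1 + sqrt(- rho) is a bounded function with nonzero integral and vanishing
   correlations on H.  No Gaussian process is needed to define eps: the
   probabilities of its cylinders are finite combinations of the numbers
   E exp(i (X_a1 + ... - X_b1 - ...)), which are explicit exponentials of the
   covariance, and they are nonnegative because
   (1 + e sin x) / 2 = |1/2 - i e exp(i x) / 2|^2 and exponentials of positive
   semidefinite kernels are positive semidefinite (Schur).  The process eps lives
   on the Cantor space, where the measure is the image of the Lebesgue measure of
   [0, 1[ under successive subdivisions of this interval. *)

Local Notation conj := Num.conj.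
Local Notation Re := (@complex.Re _).
Local Notation Im := (@complex.Im _).

(** * Positive semidefinite kernels *)

Section real_kernels.
Context (R : realType).

Definition kform (T : Type) (k : T -> T -> R) (s : seq (R * T)) : R :=
  \sum_(x <- s) \sum_(y <- s) x.1 * y.1 * k x.2 y.2.

Definition psd_kernel (T : Type) (k : T -> T -> R) : Prop :=
  (forall x y, k x y = k y x) /\ forall s, 0 <= kform k s.

Lemma kform_cons (T : Type) (k : T -> T -> R) (c : R) (a : T) s :
  (forall x y, k x y = k y x) ->
  kform k ((c, a) :: s) =
  c ^+ 2 * k a a + 2 * c * (\sum_(x <- s) x.1 * k x.2 a) + kform k s.
Proof.
move=> ksym; rewrite /kform big_cons big_cons /=.
under [X in _ + X]eq_bigr do rewrite big_cons /=.
rewrite big_split /=.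
have -> : \sum_(j <- s) c * j.1 * k a j.2 = c * \sum_(x <- s) x.1 * k x.2 a.
  by rewrite mulr_sumr; apply: eq_bigr => x _; rewrite ksym mulrA.
have -> : \sum_(i <- s) i.1 * c * k i.2 a = c * \sum_(x <- s) x.1 * k x.2 a.
  by rewrite mulr_sumr; apply: eq_bigr => x _; ring.
by ring.
Qed.

Lemma kformD (T : Type) (k l : T -> T -> R) s :
  kform (fun x y => k x y + l x y) s = kform k s + kform l s.
Proof.
rewrite /kform -big_split /=; apply: eq_bigr => x _.
by rewrite -big_split /=; apply: eq_bigr => y _; rewrite mulrDr.
Qed.

Lemma kformZ (T : Type) (k : T -> T -> R) c s :
  kform (fun x y => c * k x y) s = c * kform k s.
Proof.
rewrite /kform mulr_sumr; apply: eq_bigr => x _.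
by rewrite mulr_sumr; apply: eq_bigr => y _; ring.
Qed.

Lemma kform_conj (T : Type) (k : T -> T -> R) (u : T -> R) s :
  kform (fun x y => u x * u y * k x y) s =
  kform k [seq (x.1 * u x.2, x.2) | x <- s].
Proof.
rewrite /kform big_map; apply: eq_bigr => x _.
by rewrite big_map; apply: eq_bigr => y _ /=; ring.
Qed.

Lemma psd_kernel_diag (T : Type) (k : T -> T -> R) a :
  psd_kernel k -> 0 <= k a a.
Proof.
by move=> [_ /(_ [:: (1, a)])]; rewrite /kform !big_seq1 /= !mul1r.
Qed.

(* Schur complement of the diagonal entry at [a]; for [k a a = 0] it is [k]
   itself, because [x / 0 = 0], and [k a] vanishes by positivity. *)
Definition schur_complement (T : Type) (k : T -> T -> R) (a x y : T) : R :=
  k x y - k x a * k y a / k a a.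

(** For [k a a] nonzero, the form of the complement at [s] is the minimum over c of
    [kform k ((c, a) :: s)], attained at the coefficient used below. For [k a a = 0] that
    coefficient is 0 and nothing is subtracted. *)
Lemma schur_complement_psd (T : Type) (k : T -> T -> R) a :
  psd_kernel k -> psd_kernel (schur_complement k a).
Proof.
move=> [ksym kpos]; split=> [x y|s].
  by rewrite /schur_complement ksym [k x a * _]mulrC.
have := kpos ((- (\sum_(x <- s) x.1 * k x.2 a) / k a a, a) :: s).
rewrite kform_cons//.
have -> : kform (schur_complement k a) s =
    kform k s - (\sum_(x <- s) x.1 * k x.2 a) ^+ 2 / k a a.
  rewrite /kform /schur_complement expr2 mulr_suml mulr_suml -sumrB.
  apply: eq_bigr => x _.
  rewrite mulr_sumr mulr_suml -sumrB.
  by apply: eq_bigr => y _; ring.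
set S := \sum_(x <- s) _.
have [->|k0] := eqVneq (k a a) 0.
  by rewrite invr0 !mulr0 !mul0r add0r subr0 ?addr0.
by have -> : (- S / k a a) ^+ 2 * k a a + 2 * (- S / k a a) * S + kform k s =
  kform k s - S ^+ 2 / k a a by field.
Qed.

Lemma schur_complement0 (T : Type) (k : T -> T -> R) a x :
  psd_kernel k -> schur_complement k a x a = 0.
Proof.
move=> kpsd; have [ksym kpos] := kpsd; rewrite /schur_complement.
have [k0|k0] := eqVneq (k a a) 0; last by field.
rewrite k0 invr0 mulr0 subr0; apply/eqP; apply: contraT => kxa.
(* With [k a a = 0] and [k x a] nonzero, the form at (c, a), (1, x) is affine in c; this c gives it
   the value -1. *)
have := kpos [:: (- (k x x + 1) / (2 * k x a), a); (1, x)].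
rewrite kform_cons// k0 big_seq1 /kform !big_seq1 /= => /[dup].
have -> : (- (k x x + 1) / (2 * k x a)) ^+ 2 * 0 +
   2 * (- (k x x + 1) / (2 * k x a)) * (1 * k x a) + 1 * 1 * k x x = - 1 by field.
by rewrite lerNr oppr0 ler10.
Qed.

(* Schur's product theorem: peeling off one point at a time with the Schur
   complement writes [k] as a sum of kernels [u x * u y]. *)
Lemma psd_kernelM (T : Type) (k l : T -> T -> R) :
  psd_kernel k -> psd_kernel l -> psd_kernel (fun x y => k x y * l x y).
Proof.
move=> kpsd [lsym lpos]; have [ksym _] := kpsd.
split=> [x y|s]; first by rewrite ksym lsym.
elim: s k kpsd ksym => [|[c a] s IH] k kpsd ksym; first by rewrite /kform big_nil.
have -> : (fun x y => k x y * l x y) = (fun x y => schur_complement k a x y * l x y +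
    (k a a)^-1 * (k x a * k y a * l x y)).
  by apply/funext => x; apply/funext => y; rewrite /schur_complement; ring.
have spsd := schur_complement_psd a kpsd; have [ssym _] := spsd.
rewrite kformD kformZ addr_ge0 ?mulr_ge0 ?invr_ge0 ?psd_kernel_diag//; last first.
  by rewrite kform_conj.
(* The complement vanishes against [a], so the point [(c, a)] adds nothing and the form reduces to
   the shorter list [s]. *)
rewrite kform_cons; last by move=> x y; rewrite ssym lsym.
rewrite schur_complement0// mul0r mulr0 add0r big1 => [|x _]; last first.
  by rewrite schur_complement0// mul0r mulr0.
by rewrite mulr0 add0r; exact: IH.
Qed.

(** Powers of [k] are positive semidefinite by the product theorem. The partial sums of the
    exponential series combine them with coefficients 1/i!, and nonnegativity of the form passes to
    the limit. *)
Lemma psd_kernel_expR (T : Type) (k : T -> T -> R) :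
  psd_kernel k -> psd_kernel (fun x y => expR (k x y)).
Proof.
move=> kpsd; have [ksym _] := kpsd.
split=> [x y|s]; first by rewrite ksym.
have powpsd n : psd_kernel (fun x y => k x y ^+ n).
  elim: n => [|n IH].
    split=> // t; rewrite /kform.
    under eq_bigr do under eq_bigr do rewrite expr0 mulr1.
    by rewrite -big_distrlr /= -expr2 sqr_ge0.
  suff -> : (fun x y => k x y ^+ n.+1) = (fun x y => k x y * k x y ^+ n).
    exact: psd_kernelM.
  by apply/funext => x; apply/funext => y; rewrite exprS.
have cvg_sum (I : Type) (r : seq I) (f : I -> nat -> R) l :
    (forall i, f i @ \oo --> l i) ->
    (fun n => \sum_(i <- r) f i n) @ \oo --> \sum_(i <- r) l i.
  by move=> fl; apply: cvg_big => //; exact: add_continuous.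
have cvgk : (fun n => kform (fun x y => series (exp_coeff (k x y)) n) s) @ \oo -->
    kform (fun x y => expR (k x y)) s.
  apply: (cvg_sum) => x; apply: (cvg_sum) => y; apply: cvgMr.
  exact: is_cvg_series_exp_coeff.
rewrite -(cvg_lim _ cvgk)//; apply: limr_ge.
  by apply/cvg_ex; exists (kform (fun x y => expR (k x y)) s).
near=> n.
rewrite [leRHS](_ : _ = \sum_(0 <= i < n) (i`!%:R)^-1 * kform (fun x y => k x y ^+ i) s).
  by apply: sumr_ge0 => i _; rewrite mulr_ge0 ?invr_ge0//; have [_] := powpsd i; exact.
elim: {+}n => [|m IH].
  rewrite big_geq// /kform big1// => x _; rewrite big1// => y _.
  by rewrite /series /= big_geq// mulr0.
rewrite big_nat_recr//= -IH -kformZ -kformD; congr kform.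
apply/funext => x; apply/funext => y.
by rewrite /series /= big_nat_recr//= /exp_coeff /= [_^-1 * _]mulrC.
Unshelve. all: by end_near. Qed.

End real_kernels.

Section complex_kernels.
Context (R : realType).

Definition cform (T : Type) (k : T -> T -> R[i]) (s : seq (R[i] * T)) : R[i] :=
  \sum_(x <- s) \sum_(y <- s) x.1 * y.1^* * k x.2 y.2.

(** The real and the imaginary parts of the coefficients each contribute a real form; the cross
    terms cancel by symmetry of [k]. *)
Lemma cform_real (T : Type) (k : T -> T -> R) s :
  psd_kernel k -> 0 <= cform (fun x y => (k x y)%:C) s.
Proof.
move=> [ksym kpos].
have -> : cform (fun x y => (k x y)%:C) s =
    (kform k [seq (Re x.1, x.2) | x <- s] +
     kform k [seq (Im x.1, x.2) | x <- s])%:C +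
    'i * ((\sum_(x <- s) \sum_(y <- s)
            Im x.1 * Re y.1 * k x.2 y.2) -
          (\sum_(x <- s) \sum_(y <- s)
            Im y.1 * Re x.1 * k x.2 y.2))%:C.
  rewrite /cform /kform !big_map -big_split -sumrB !rmorph_sum mulr_sumr -big_split.
  apply: eq_bigr => x _ /=.
  rewrite !big_map -big_split -sumrB !rmorph_sum mulr_sumr -big_split.
  apply: eq_bigr => y _ /=.
  case: x y => [[a b] x] [[c d] y] /=.
  by apply/eqP; rewrite eq_complex /=; apply/andP; split; apply/eqP; ring.
rewrite [X in _ - X]exchange_big /=.
under [X in _ - X]eq_bigr do under eq_bigr do rewrite ksym.
by rewrite subrr mulr0 addr0 ler0c addr_ge0.
Qed.

End complex_kernels.

(** * The sine-modulated sign process *)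

Section sine_process.
Context (R : realType) (I : eqType) (K : I -> I -> R).
Hypothesis Kpsd : psd_kernel K.

Definition lsum (u v : seq I) : R := \sum_(a <- u) \sum_(b <- v) K a b.

Lemma lsumC u v : lsum u v = lsum v u.
Proof.
rewrite /lsum exchange_big; apply: eq_bigr => b _; apply: eq_bigr => a _.
by have [->] := Kpsd.
Qed.

Lemma lsum_cat u v w : lsum (u ++ v) w = lsum u w + lsum v w.
Proof. by rewrite /lsum big_cat. Qed.

Lemma lsum_nil v : lsum [::] v = 0.
Proof. by rewrite /lsum big_nil. Qed.

Lemma lsum_cons a v w : lsum (a :: v) w = lsum [:: a] w + lsum v w.
Proof. by rewrite -lsum_cat. Qed.

Lemma lsum_seq1 a b : lsum [:: a] [:: b] = K a b.
Proof. by rewrite /lsum !big_seq1. Qed.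

(** A form in words expands into a form in letters, each letter carrying the coefficient of its
    word. *)
Lemma lsum_psd : psd_kernel lsum.
Proof.
split=> [|s]; first exact: lsumC.
have [_ /(_ (flatten [seq [seq (x.1, a) | a <- x.2] | x <- s]))] := Kpsd.
congr (_ <= _); rewrite /kform big_flatten big_map; apply: eq_bigr => x _.
rewrite big_map.
under eq_bigr do rewrite big_flatten big_map.
rewrite exchange_big; apply: eq_bigr => y _ /=.
rewrite /lsum mulr_sumr; apply: eq_bigr => a _.
by rewrite big_map mulr_sumr.
Qed.

(* [gauss u v] is the expectation of exp (i (sum_(a in u) X_a - sum_(b in v) X_b))
   for a centred Gaussian family X with covariance K. *)
Definition gauss (u v : seq I) : R :=
  expR (lsum u v - (lsum u u + lsum v v) / 2).

Lemma gauss_psd : psd_kernel gauss.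
Proof.
split=> [u v|s]; first by rewrite /gauss lsumC [lsum u u + _]addrC.
(* Up to factors depending on [u] or [v] alone, which the coefficients absorb, [gauss] is the
   exponential of [lsum]. *)
have -> : gauss = fun u v =>
    expR (- lsum u u / 2) * expR (- lsum v v / 2) * expR (lsum u v).
  apply/funext => u; apply/funext => v; rewrite -!expRD; congr expR; by field.
by rewrite kform_conj; have [_] := psd_kernel_expR lsum_psd; exact.
Qed.

(* [sine s u v] is the expectation, for the same X, of
     exp (i (sum_(a in u) X_a - sum_(b in v) X_b)) *
     \prod_((a, e) in s) (1 + (-1)^(1-e) sin X_a) / 2,
   computed with (1 + e sin x) / 2 = |1/2 - i e exp(i x) / 2|^2. *)
Fixpoint sine (s : seq (I * bool)) (u v : seq I) : R[i] :=
  if s is (a, e) :: s' then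
    (sine s' u v + sine s' (a :: u) (a :: v)) / 4 +
    (if e then 1 else -1) * 'i / 4 * (sine s' u (a :: v) - sine s' (a :: u) v)
  else (gauss u v)%:C.

(** The factor for (a, e) is the squared modulus of 1/2 - i e exp(i X_a) / 2. Its two terms are
    absorbed by doubling the family [t]: each (c, u) is replaced by (c / 2, u) and (- i e c / 2, a
    :: u). *)
Lemma cform_sine s t : 0 <= cform (sine s) t.
Proof.
elim: s t => [|[a e] s IH] t; first exact: cform_real gauss_psd.
have := IH ([seq (x.1 / 2, x.2) | x <- t] ++
  [seq (- (if e then 1 else -1) * 'i / 2 * x.1, a :: x.2) | x <- t]).
congr (_ <= _); rewrite /cform big_cat /= !big_map -big_split /=.
apply: eq_bigr => x _.
rewrite !big_cat /= !big_map -!big_split /=; apply: eq_bigr => y _ /=.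
have i2 : 'i * 'i = -1 :> R[i] by rewrite -expr2 sqr_i.
have ci : conj 'i = - 'i :> R[i].
  by apply/eqP; rewrite eq_complex /= oppr0 !eqxx.
have c2 : conj (2^-1 : R[i]) = 2^-1 by rewrite fmorphV rmorph_nat.
have cM (z w : R[i]) : conj (z * w) = conj z * conj w.
  exact: rmorphM.
have cN (z : R[i]) : conj (- z) = - conj z by exact: rmorphN.
have c1 : conj (1 : R[i]) = 1 by exact: rmorph1.
by case: e; rewrite !(cM, cN) ci c2 ?c1; field: i2.
Qed.

(** Unfolding [sine s u v] only produces values of [gauss] at words extending [u] and [v], so
    identities for [sine] reduce to identities for [gauss]. *)
Lemma sine_eqv s u v u' v' :
  (forall c d, gauss (c ++ u) (d ++ v) = gauss (c ++ u') (d ++ v')) ->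
  sine s u v = sine s u' v'.
Proof.
elim: s u v u' v' => [|[a e] s IH] u v u' v' h /=.
  by have := h [::] [::]; rewrite /= => ->.
by congr ((_ + _) / _ + _ * (_ - _)); apply: IH => c d;
  rewrite -?cat_rcons h.
Qed.

(** The phases of X_a on the two sides cancel: the exponent of [gauss] is minus half the quadratic
    form of [K] at the difference of the two words. *)
Lemma sine_shift s a u v : sine s (a :: u) (a :: v) = sine s u v.
Proof.
apply: sine_eqv => c d; congr expR.
have lE x y w : lsum (x ++ a :: y) w = lsum x w + (lsum [:: a] w + lsum y w).
  by rewrite lsum_cat lsum_cons.
have rE w x y : lsum w (x ++ a :: y) = lsum w x + (lsum w [:: a] + lsum w y).
  by rewrite lsumC lE !(lsumC w).
have catr w x y : lsum w (x ++ y) = lsum w x + lsum w y.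
  by rewrite lsumC lsum_cat !(lsumC w).
rewrite !lE !rE !lsum_cat !catr.
rewrite (lsumC [:: a] c) (lsumC [:: a] d) (lsumC [:: a] u) (lsumC [:: a] v).
rewrite (lsumC u c) (lsumC v d).
by field.
Qed.

Lemma lsum_swap c a b u w : lsum (c ++ a :: b :: u) w = lsum (c ++ b :: a :: u) w.
Proof.
rewrite !lsum_cat (lsum_cons a (b :: u)) (lsum_cons b u).
by rewrite (lsum_cons b (a :: u)) (lsum_cons a u); congr (_ + _); rewrite addrCA.
Qed.

Lemma sine_swapl s a b u v : sine s (a :: b :: u) v = sine s (b :: a :: u) v.
Proof.
apply: sine_eqv => c d; rewrite /gauss.
by rewrite !(lsum_swap c a b) [lsum _ (c ++ a :: _)]lsumC (lsum_swap c a b).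
Qed.

Lemma sine_swapr s a b u v : sine s u (a :: b :: v) = sine s u (b :: a :: v).
Proof.
apply: sine_eqv => c d; rewrite /gauss.
by rewrite !(lsum_swap d a b) ![lsum _ (d ++ a :: _)]lsumC !(lsum_swap d a b)
  [lsum _ (c ++ u)]lsumC.
Qed.

Lemma sine_swap s x y u v : sine [:: x, y & s] u v = sine [:: y, x & s] u v.
Proof.
case: x y => [a e] [b f] /=.
have -> : sine s (a :: b :: u) (a :: b :: v) = sine s (b :: a :: u) (b :: a :: v).
  by rewrite sine_swapl sine_swapr.
rewrite !(sine_swapl s a b) !(sine_swapr s a b).
by case: e; case: f; ring.
Qed.

Lemma sine_perm s t u v : perm_eq s t -> sine s u v = sine t u v.
Proof.
have move_front x s1 s2 : sine (s1 ++ x :: s2) =2 sine (x :: s1 ++ s2).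
  elim: s1 => //= y s1 IH u' v'.
  by rewrite -/(sine [:: x, y & s1 ++ s2] u' v') sine_swap; case: y => a e /=;
    rewrite !IH.
elim: s t u v => [|x s IH] t u v; first by move/perm_size; case: t.
move=> st; have /splitPr xt : x \in t by rewrite -(perm_mem st) mem_head.
case: xt st => t1 t2 st; rewrite move_front; case: x st {move_front} => a e st /=.
have {}st : perm_eq s (t1 ++ t2).
  by rewrite -(perm_cons (a, e)) (perm_trans st)// perm_catC /= perm_cons perm_catC.
by rewrite !(IH _ _ _ st).
Qed.

(** The terms with 'i cancel, and the two remaining ones agree by [sine_shift], which expresses that
    exp(i X_a) has modulus 1. *)
Lemma sine_split a s u v :
  sine ((a, true) :: s) u v + sine ((a, false) :: s) u v = sine s u v.
Proof. by rewrite /= sine_shift; field. Qed.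

(** Applied to translations, this is the source of the invariance of the measure. *)
Lemma sine_map (f : I -> I) s u v : (forall a b, K (f a) (f b) = K a b) ->
  sine [seq (f x.1, x.2) | x <- s] (map f u) (map f v) = sine s u v.
Proof.
move=> fK; elim: s u v => [|[a e] s IH] u v /=.
  have lm u' v' : lsum (map f u') (map f v') = lsum u' v'.
    by rewrite /lsum big_map; apply: eq_bigr => i _; rewrite big_map; apply: eq_bigr.
  by rewrite /gauss !lm.
by rewrite -!map_cons !IH.
Qed.

(* P(eps_a = e for all (a, e) in s), for signs eps that are independent with
   means sin X_a conditionally on X. *)
Definition sign_prob (s : seq (I * bool)) : R := Re (sine s [::] [::]).

Lemma sign_prob_ge0 s : 0 <= sign_prob s.
Proof.
have := cform_sine s [:: (1, [::])].
by rewrite /cform !big_seq1 /= conjC1 !mul1r lecE => /andP[].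
Qed.

Lemma sign_prob_nil : sign_prob [::] = 1.
Proof. by rewrite /sign_prob /= /gauss lsum_nil addr0 mul0r subr0 expR0. Qed.

Lemma sign_prob_split a s :
  sign_prob ((a, true) :: s) + sign_prob ((a, false) :: s) = sign_prob s.
Proof. by rewrite /sign_prob -raddfD sine_split. Qed.

Lemma sign_prob_perm s t : perm_eq s t -> sign_prob s = sign_prob t.
Proof. by move=> st; rewrite /sign_prob (sine_perm _ _ st). Qed.

Lemma sign_prob_map (f : I -> I) s : (forall a b, K (f a) (f b) = K a b) ->
  sign_prob [seq (f x.1, x.2) | x <- s] = sign_prob s.
Proof. by move=> fK; rewrite /sign_prob (sine_map s [::] [::] fK). Qed.

Lemma sine1 a u v : sine [:: (a, true)] u v =
  (gauss u v / 2)%:C + 'i * ((gauss u (a :: v) - gauss (a :: u) v) / 4)%:C.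
Proof.
have := sine_shift [::] a u v; rewrite /= => ->.
by apply/eqP; rewrite eq_complex /=; apply/andP; split; apply/eqP; field.
Qed.

Lemma sign_prob1 a : sign_prob [:: (a, true)] = 1 / 2.
Proof.
have g0 : gauss [::] [::] = 1 by rewrite /gauss lsum_nil addr0 mul0r subr0 expR0.
by rewrite /sign_prob sine1 g0 /=; field.
Qed.

(** This is (1 + E(sin X_a sin X_b)) / 4, where the sines have mean 0 and their product is (cos(X_a
    - X_b) - cos(X_a + X_b)) / 2. *)
Lemma sign_prob2 a b : sign_prob [:: (a, true); (b, true)] =
  (1 + (expR (K a b - (K a a + K b b) / 2)
      - expR (- K a b - (K a a + K b b) / 2)) / 2) / 4.
Proof.
rewrite /sign_prob.
have -> : sine [:: (a, true); (b, true)] [::] [::] =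
    ((sine [:: (b, true)] [::] [::] + sine [:: (b, true)] [:: a] [:: a]) / 4 +
     1 * 'i / 4 * (sine [:: (b, true)] [::] [:: a] - sine [:: (b, true)] [:: a] [::])).
  by [].
have [gC _] := gauss_psd.
have g0 : gauss [::] [::] = 1 by rewrite /gauss lsum_nil addr0 mul0r subr0 expR0.
have gm : gauss [:: b] [:: a] = expR (K a b - (K a a + K b b) / 2).
  by rewrite gC /gauss !lsum_seq1.
have gp : gauss [::] [:: b; a] = expR (- K a b - (K a a + K b b) / 2).
  rewrite /gauss !lsum_nil !(lsum_cons b [:: a]) ![lsum _ [:: b; a]]lsumC.
  rewrite !(lsum_cons b [:: a]) (lsumC [:: b] [:: a]) !lsum_seq1; congr expR.
  by field.
rewrite sine_shift !sine1 (gC [:: b] [::]) (gC [:: a] [::]) (gC [:: b; a]) (gC [:: a]).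
rewrite g0 gm gp /= => {g0 gm gp}.
by field.
Qed.

End sine_process.

(** * Probability measures on the Cantor space *)

(** [standard_borel] asks for a complete pseudometric structure: the pseudometric is that of a
    countable product of copies of [bool], and completeness comes from compactness. *)
HB.instance Definition _ (R : realType) :=
  PseudoMetric.copy cantor_space
    (prod_topology (fun _ : nat => (bool : pseudoMetricType R))).

HB.instance Definition _ := Uniform_isComplete.Build cantor_space
  (fun F FF cF => compact_cauchy_cvg FF cF filterT cantor_space_compact).

Definition cantor_borel := g_sigma_algebraType (@open cantor_space).

Lemma cantor_standard_borel (R : realType) : standard_borel R cantor_borel.
Proof.
exists (cantor_space : completePseudoMetricType R); split.
- exact: cantor_space_hausdorff.
- exact: (@compact_second_countable R cantor_space cantor_space_compact).
- by exists id; first by exists id.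
Qed.

Definition cyl (s : seq (nat * bool)) : set cantor_space :=
  [set x | all (fun p => x p.1 == p.2) s].

Lemma cyl_cat s t : cyl (s ++ t) = cyl s `&` cyl t.
Proof.
apply/seteqP; split=> x /=; rewrite /cyl /= all_cat; first by move/andP.
by move=> [] /= -> ->.
Qed.

Lemma cyl_cons p s : cyl (p :: s) = [set x | x p.1 = p.2] `&` cyl s.
Proof.
apply/seteqP; split=> x; rewrite /cyl /=; first by move=> /andP[/eqP].
by move=> [/eqP -> ->].
Qed.

Lemma open_cyl s : open (cyl s).
Proof.
elim: s => [|p s IH].
  by rewrite (_ : cyl [::] = setT); [exact: openT|apply/seteqP].
rewrite cyl_cons; apply: openI => //.
have projc := @proj_continuous nat (fun=> bool : topologicalType) p.1.
have [oproj _] := @continuousP cantor_space bool (fun x : cantor_space => x p.1).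
by apply: (oproj projc [set p.2]); exact: discrete_open.
Qed.

(** The cylinders through [x] generate a filter. It converges to [x] because the product topology is
    the supremum of the topologies pulled back from the coordinates. *)
Lemma nbhs_cyl (x : cantor_space) (U : set cantor_space) : nbhs x U ->
  exists2 s, cyl s x & cyl s `<=` U.
Proof.
move=> xU; pose F := filter_from [set s | cyl s x] cyl.
have FF : Filter F.
  apply: filter_from_filter; first by exists [::].
  by move=> s t sx tx; exists (s ++ t); rewrite /= cyl_cat.
suff /(_ U xU) [s] : F --> x by exists s.
apply/cvg_sup => i.
have evalT : (fun f : nat -> bool => f i) @` setT = setT.
  by apply/seteqP; split=> // b _; exists (fun=> b).
apply/cvg_image => // A /principal_filterP Ax.
exists ((fun f : nat -> bool => f i) @^-1` A); last exact: image_preimage.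
exists [:: (i, x i)]; first by rewrite /= /cyl /= eqxx.
by move=> y; rewrite /cyl /= andbT => /eqP ->.
Qed.

Lemma open_bigcup_cyl (U : set cantor_space) : open U ->
  U = \bigcup_(s in [set s | cyl s `<=` U]) cyl s.
Proof.
rewrite openE => oU; apply/seteqP; split=> [x /oU /nbhs_cyl[s sx sU]|x [s sU /sU]//].
by exists s.
Qed.

Lemma sigma_open_cyl : <<s @open cantor_space >> = <<s range cyl >>.
Proof.
apply/seteqP; split; apply: smallest_sub; try exact: smallest_sigma_algebra.
  (* There are countably many finite lists of constraints, so this union is countable. *)
  move=> U oU; rewrite (open_bigcup_cyl oU) bigcup_mkcond.
  apply: (@countable_bigcupT_measurable _ (g_sigma_algebraType (range cyl))) => // s.
  by case: ifP => _; [apply: sub_sigma_algebra; exists s|exact: measurable0].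
by move=> _ [s _ <-]; apply: sub_sigma_algebra; exact: open_cyl.
Qed.

Lemma measurable_cyl s : measurable (cyl s : set cantor_borel).
Proof. by apply: sub_sigma_algebra; exact: open_cyl. Qed.

Lemma measurable_fun_cantor d (T : measurableType d) (f : T -> cantor_borel) :
  (forall i b, measurable (f @^-1` [set x | x i = b])) ->
  measurable_fun setT f.
Proof.
move=> mf; apply: (@measurability _ _ T cantor_borel setT f (range cyl)).
  by rewrite /measurable /= sigma_open_cyl.
move=> _ [_ [s _ <-] <-]; rewrite setTI.
elim: s => [|p s IH].
  by rewrite (_ : _ @^-1` _ = setT)//; apply/seteqP.
by rewrite cyl_cons preimage_setI; exact: measurableI.
Qed.

(** * Measures with prescribed cylinder masses *)

Section uniform01.
Context (R : realType).

(** A measure on the whole line without mass off [0, 1[, so that the values of [bits] elsewhere do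
    not matter. *)
Definition lebesgue01 :=
  mrestr (@lebesgue_measure R) (measurable_itv `[0 : R, 1[).

HB.instance Definition _ := Measure.on lebesgue01.

Let lebesgue01_setT : lebesgue01 setT = 1%E.
Proof.
by rewrite /lebesgue01 /mrestr setTI lebesgue_measure_itv /= lte_fin ltr01 sube0.
Qed.

HB.instance Definition _ := Measure_isProbability.Build _ _ _ lebesgue01
  lebesgue01_setT.

End uniform01.

Section cantor_measure.
Context (R : realType) (q : seq (nat * bool) -> R).
Hypothesis q_ge0 : forall s, 0 <= q s.
Hypothesis q_nil : q [::] = 1.
Hypothesis q_split : forall k s, q ((k, true) :: s) + q ((k, false) :: s) = q s.
Hypothesis q_perm : forall s t, perm_eq s t -> q s = q t.

(* A finite word lists the values of a point at 0, ..., size w - 1, the last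
   one first. *)
Fixpoint word_cyl (w : seq bool) : seq (nat * bool) :=
  if w is b :: w' then (size w', b) :: word_cyl w' else [::].

Local Notation pw w := (q (word_cyl w)).

(* The intervals [left_end w, left_end w + pw w[ of the words of length n
   partition [0, 1[. *)
Fixpoint left_end (w : seq bool) : R :=
  if w is b :: w' then left_end w' + (if b then pw (false :: w') else 0) else 0.

Fixpoint word (n : nat) (x : R) : seq bool :=
  if n is n'.+1 then
    let w := word n' x in (left_end w + pw (false :: w) <= x) :: w
  else [::].

Definition bits (x : measurableTypeR R) : cantor_borel :=
  fun n => let w := word n x in left_end w + pw (false :: w) <= x.

Lemma wordS n x : word n.+1 x = bits x n :: word n x.
Proof. by []. Qed.

Lemma size_word n x : size (word n x) = n.
Proof. by elim: n => //= n ->. Qed.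

(** The interval of [w] is cut at [left_end w + pw (false :: w)], with [false] on the left. By
    [q_split] the two pieces fill it, and since their lengths are nonnegative, a point of either
    piece lies in the interval of [w]. *)
Lemma word_itv w x : 0 <= x < 1 ->
  (word (size w) x == w) = (left_end w <= x < left_end w + pw w).
Proof.
move=> x01; elim: w => [|b w IH] /=; first by rewrite q_nil add0r eqxx x01.
rewrite eqseq_cons; have [ww|ww] := eqVneq (word (size w) x) w.
  rewrite ww andbT /=; move: IH; rewrite ww eqxx => /esym/andP[lx xr].
  have := q_split (size w) (word_cyl w); have := q_ge0 (word_cyl (false :: w)).
  case: b => /= q0 qs; last by rewrite eqbF_neg -ltNge addr0 lx.
  by rewrite eqb_id (_ : x < _) ?andbT//; lra.
rewrite andbF; apply/esym/negP => /andP[lx xr].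
move: IH; rewrite (negbTE ww) => /esym/negP; apply.
have := q_split (size w) (word_cyl w); have := q_ge0 (word_cyl (false :: w)).
have := q_ge0 (word_cyl (true :: w)).
by case: b lx xr => /= lx xr; lra.
Qed.

Lemma bits_word_cyl w x : cyl (word_cyl w) (bits x) = (word (size w) x == w) :> Prop.
Proof.
congr is_true; elim: w => [|b w IH]//.
by rewrite [size _]/= wordS eqseq_cons -IH.
Qed.

Lemma measurable_word w : measurable [set x | word (size w) x = w].
Proof.
elim: w => [|b w IH]; first by rewrite (_ : mkset _ = setT)//; apply/seteqP.
rewrite (_ : mkset _ = [set x | word (size w) x = w] `&`
    (if b then `[left_end w + pw (false :: w), +oo[%classic
     else `]-oo, left_end w + pw (false :: w)[%classic)).
  by apply: measurableI => //; case: b; exact: measurable_itv.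
apply/seteqP; split => x /=.
  by move=> [bx ww]; split=> //; move: bx; rewrite ww; case: b => /=;
    rewrite in_itv /= ?andbT// => /negbT; rewrite -ltNge.
move=> [ww]; rewrite ww; case: b; rewrite /= in_itv /= ?andbT => bx.
  by rewrite bx.
by rewrite leNgt bx.
Qed.

Lemma measurable_bits : measurable_fun setT bits.
Proof.
apply: measurable_fun_cantor => i b.
rewrite (_ : _ @^-1` _ = \bigcup_(w in [set w | size w = i])
    [set x | word (size (b :: w)) x = b :: w]); last first.
  apply/seteqP; split=> x /=; last by move=> [w /= <-] [].
  move=> xb; exists (word i x); first exact: size_word.
  change (word (size (word i x)).+1 x = b :: word i x).
  by rewrite size_word wordS xb.
rewrite bigcup_mkcond; apply: countable_bigcupT_measurable => // w.
by case: ifP => // _; exact: measurable_word.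
Qed.

HB.instance Definition _ := isMeasurableFun.Build _ _ _ _ bits measurable_bits.

Definition cantor_measure : probability cantor_borel R :=
  distribution (@lebesgue01 R) bits.

Lemma cantor_measure_word w : cantor_measure (cyl (word_cyl w)) = (pw w)%:E.
Proof.
rewrite /cantor_measure /= /distribution /pushforward /= /lebesgue01 /mrestr.
have lr : forall w, 0 <= left_end w /\ left_end w + pw w <= 1.
  elim=> [|b v [l r]]; first by rewrite /= q_nil add0r.
  have := q_split (size v) (word_cyl v); have := q_ge0 (word_cyl (false :: v)).
  have := q_ge0 (word_cyl (true :: v)).
  by case: b => /=; split; lra.
rewrite (_ : _ `&` _ = `[left_end w, left_end w + pw w[%classic); last first.
  have [l r] := lr w.
  apply/seteqP; split=> x /=; rewrite bits_word_cyl !in_itv /=.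
    by move=> [+ x01]; rewrite word_itv.
  move=> /[dup] /andP[lx xr] xlr.
  have x01 : 0 <= x < 1 by rewrite (le_trans l lx) (lt_le_trans xr r).
  by rewrite word_itv.
rewrite lebesgue_measure_itv /= lte_fin ltrDl; have := q_ge0 (word_cyl w).
(* A word of mass 0 has an empty interval, for which the comparison in the length formula is
   false. *)
rewrite le_eqVlt => /predU1P[<-|->]; first by rewrite ltxx.
by rewrite -EFinB addrAC subrr add0r.
Qed.

Lemma word_cyl_rev (b : nat -> bool) n :
  perm_eq (word_cyl (rev [seq b k | k <- iota 0 n])) [seq (k, b k) | k <- iota 0 n].
Proof.
elim: n => // n IH; rewrite -addn1 iotaD !map_cat add0n /= rev_cat /=.
by rewrite size_rev size_map size_iota perm_sym cats1 perm_rcons perm_cons perm_sym.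
Qed.

Lemma cyl_perm s t : perm_eq s t -> cyl s = cyl t.
Proof.
by move=> st; apply/funext => x; rewrite /cyl /=; congr is_true; exact: perm_all.
Qed.

Lemma uniq_fst_inj (s : seq (nat * bool)) k e e' :
  uniq (map fst s) -> (k, e) \in s -> (k, e') \in s -> e = e'.
Proof.
elim: s => //= -[k0 e0] s IH /andP[/= ks us]; rewrite !in_cons !xpair_eqE.
move=> /orP[/andP[/eqP kk /eqP ->]|ke] /orP[/andP[/eqP kk' /eqP ->]|ke'] //.
- by move: ks; rewrite -kk (map_f fst ke').
- by move: ks; rewrite -kk' (map_f fst ke).
- exact: IH.
Qed.

Lemma cantor_measure_full s n : perm_eq (map fst s) (iota 0 n) ->
  cantor_measure (cyl s) = (q s)%:E.
Proof.
move=> sn; pose b k := (k, true) \in s.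
have us : uniq (map fst s) by rewrite (perm_uniq sn) iota_uniq.
have sE : s = [seq (k, b k) | k <- map fst s].
  rewrite -map_comp -[LHS]map_id; apply/eq_in_map => -[k e] ks /=.
  congr pair; rewrite /b; case: e ks => [->//|ks]; apply/esym/negP => kt.
  by have := uniq_fst_inj us ks kt.
have sw : perm_eq s (word_cyl (rev [seq b k | k <- iota 0 n])).
  by rewrite sE perm_sym (perm_trans (word_cyl_rev b n))// perm_map// perm_sym.
by rewrite (cyl_perm sw) (q_perm sw) cantor_measure_word.
Qed.

(** Induction on the list [t] of coordinates below a bound that [s] leaves free: each is split into
    its two values by [q_split], until all coordinates below the bound are fixed. *)
Lemma cantor_measure_cyl s : uniq (map fst s) ->
  cantor_measure (cyl s) = (q s)%:E.
Proof.
move=> us; pose n := (\max_(k <- map fst s) k).+1.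
pose t := [seq k <- iota 0 n | k \notin map fst s].
have : perm_eq (map fst s ++ t) (iota 0 n).
  rewrite perm_sym -(perm_filterC (mem (map fst s))) perm_cat2r uniq_perm//.
    by rewrite filter_uniq// iota_uniq.
  move=> k; rewrite mem_filter mem_iota add0n leq0n /=; case: (boolP (k \in _)) => //= ks.
  by rewrite /n ltnS (leq_bigmax_seq (F := id) k).
clearbody t; clearbody n; elim: t s {us} => [|k t IH] s.
  by rewrite cats0; exact: cantor_measure_full.
move=> st.
have step b : cantor_measure (cyl ((k, b) :: s)) = (q ((k, b) :: s))%:E.
  apply: IH; rewrite (perm_trans _ st)//=.
  by rewrite perm_sym perm_catC /= perm_cons perm_catC.
have -> : cyl s = cyl ((k, true) :: s) `|` cyl ((k, false) :: s).
  rewrite !cyl_cons; apply/seteqP; split=> x /=; last by move=> [] [].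
  by move=> sx; case: (x k); [left|right].
rewrite measureU; [|exact: measurable_cyl|exact: measurable_cyl|]; last first.
  by rewrite !cyl_cons -subset0 => x /= [[-> _] []].
by rewrite -(q_split k s) EFinD; congr adde; exact: step.
Qed.

End cantor_measure.

(** When an index is repeated, [q s] need not be the mass of [cyl s]; the constraints are then
    either contradictory or redundant. *)
Lemma cyl_uniq s :
  cyl s = set0 \/ exists2 t, uniq (map fst t) & cyl s = cyl t.
Proof.
elim: s => [|[k b] s IH]; first by right; exists [::].
case: IH => [s0|[t ut st]]; first by left; rewrite cyl_cons s0 setI0.
have [kt|kt] := boolP (k \in map fst t); last first.
  by right; exists ((k, b) :: t); rewrite /= ?kt// !cyl_cons st.
have [[k' e] /= et kk] := mapP kt; rewrite -{}kk in et.
have tx (x : cantor_space) : cyl t x -> x k = e by move=> /allP /(_ _ et) /eqP.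
have [be|be] := eqVneq b e; [right; exists t => //|left];
  rewrite cyl_cons st; apply/seteqP; split=> x //=.
- by case.
- by move=> xt; split=> //; rewrite be tx.
- by case=> xb /tx xe; case/eqP: be; rewrite -xb.
Qed.

Section precomposition.
Context (R : realType) (q : seq (nat * bool) -> R).
Hypothesis q_ge0 : forall s, 0 <= q s.
Hypothesis q_nil : q [::] = 1.
Hypothesis q_split : forall k s, q ((k, true) :: s) + q ((k, false) :: s) = q s.
Hypothesis q_perm : forall s t, perm_eq s t -> q s = q t.

Definition precomp (f : nat -> nat) (x : cantor_borel) : cantor_borel := x \o f.

Lemma preimage_precomp_cyl f s :
  precomp f @^-1` cyl s = cyl [seq (f x.1, x.2) | x <- s].
Proof.
by apply/funext => x; rewrite /cyl /=; congr is_true; rewrite all_map.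
Qed.

Lemma measurable_precomp f : measurable_fun setT (precomp f).
Proof.
apply: measurable_fun_cantor => i b.
rewrite (_ : _ @^-1` _ = cyl [:: (f i, b)]); first exact: measurable_cyl.
by rewrite cyl_cons; apply/seteqP; split=> x /=; [|case].
Qed.

HB.instance Definition _ f :=
  isMeasurableFun.Build _ _ _ _ (precomp f) (measurable_precomp f).

(** Cylinders form a generating pi-system, so it suffices to compare the two measures there.
    Injectivity of [f] keeps the indices distinct, which [cantor_measure_cyl] requires. *)
Lemma cantor_measure_precomp f (A : set cantor_borel) :
  injective f -> (forall s, q [seq (f x.1, x.2) | x <- s] = q s) ->
  measurable A ->
  cantor_measure q (precomp f @^-1` A) = cantor_measure q A.
Proof.
move=> finj fq; pose nu : {measure set cantor_borel -> \bar R} :=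
  distribution (cantor_measure q) (precomp f).
rewrite {1}/measurable /= sigma_open_cyl => mA.
apply: (@g_sigma_algebra_measure_unique _ R cantor_borel (range cyl) _
  (fun=> setT) _ _ nu (cantor_measure q)) mA.
- by move=> _ [s _ <-]; exact: measurable_cyl.
- by move=> _; exists [::] => //; apply/seteqP.
- by rewrite bigcup_const.
- by move=> _ _ [s _ <-] [t _ <-]; exists (s ++ t); rewrite ?cyl_cat.
- move=> _ [s _ <-]; change (nu (cyl s)) with (cantor_measure q (precomp f @^-1` cyl s)).
  have [->|[t ut ->]] := cyl_uniq s; first by rewrite preimage_set0.
  rewrite preimage_precomp_cyl cantor_measure_cyl// ?fq//.
    exact/esym/cantor_measure_cyl.
  by rewrite -map_comp (map_comp f fst) (map_inj_uniq finj).
- by move=> _; rewrite ltey_eq fin_num_measure.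
Qed.

End precomposition.

(** * The sign process of a positive definite function *)

Section positive_definite_kernel.
Context (R : realType) (G : groupType) (phi : G -> R[i]).
Hypothesis phi_pd : positive_definite phi.

Lemma positive_definite_ge0 : 0 <= phi 1%g.
Proof.
have := @phi_pd 1 (fun=> 1%g) (fun=> 1).
by rewrite !big_ord1 conjC1 !mul1r mulVg.
Qed.

Lemma positive_definite_ReV g : Re (phi g^-1%g) = Re (phi g).
Proof.
(* With coefficients 1 at g and 'i at 1, the imaginary part of the form is Re phi(g^-1) - Re phi(g),
   since phi(1) is real. *)
have := @phi_pd 2 (fun i => if i == 0 then g else 1%g)
  (fun i => if i == 0 then 1 else 'i).
rewrite !big_ord_recl !big_ord0 /= !addr0 /= !mulVg !(mulg1, invg1, mul1g).
have := positive_definite_ge0; case: (phi 1%g) => a b; case: (phi g) => c d.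
case: (phi g^-1%g) => e f; rewrite !lecE /= => /andP[/eqP -> _] /andP[/eqP + _].
by rewrite /=; move=> h; lra.
Qed.

Definition pd_kernel (a b : G) : R := Re (phi (b^-1 * a)%g).

Lemma pd_kernel_psd : psd_kernel pd_kernel.
Proof.
split=> [a b|s].
  by rewrite /pd_kernel -positive_definite_ReV invgM invgK.
pose x0 : R * G := (0, 1%g).
have := @phi_pd (size s) (fun i => (nth x0 s i).2) (fun i => ((nth x0 s i).1)%:C).
rewrite lecE => /andP[_]; congr (_ <= _).
rewrite /kform raddf_sum (big_nth x0) big_mkord; apply: eq_bigr => i _.
rewrite raddf_sum (big_nth x0) big_mkord; apply: eq_bigr => j _ /=.
rewrite /pd_kernel; case: (phi _) => a b /=; by ring.
Qed.

Lemma pd_kernel_mull g a b : pd_kernel (g * a)%g (g * b)%g = pd_kernel a b.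
Proof. by rewrite /pd_kernel invgM -mulgA mulKg. Qed.

End positive_definite_kernel.

Section sign_system.
Context (R : realType) (G : groupType) (phi : G -> R[i]).
Hypothesis phi_pd : positive_definite phi.
Context (en : nat -> G) (rk : G -> nat).
Hypothesis enK : cancel en rk.
Hypothesis rkK : cancel rk en.

Let K (i j : nat) := pd_kernel phi (en i) (en j).

Let K_psd : psd_kernel K.
Proof.
have [Ksym Kpos] := pd_kernel_psd phi_pd.
split=> [i j|s]; first exact: Ksym.
have := Kpos [seq (x.1, en x.2) | x <- s]; rewrite /kform big_map.
by under eq_bigr do rewrite big_map.
Qed.

Let q := sign_prob K.
Let q_ge0 s : 0 <= q s. Proof. exact: sign_prob_ge0. Qed.
Let q_nil : q [::] = 1. Proof. exact: sign_prob_nil. Qed.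
Let q_split k s : q ((k, true) :: s) + q ((k, false) :: s) = q s.
Proof. exact: sign_prob_split. Qed.
Let q_perm s t : perm_eq s t -> q s = q t.
Proof. exact: sign_prob_perm. Qed.

(** Precomposition reverses the order of composition; the inverse restores a left action. *)
Let translate (g : G) (i : nat) := rk (g^-1 * en i)%g.

Definition sign_system : mps R G.
Proof.
refine (@Mps R G _ cantor_borel (cantor_measure q)
  (fun g => precomp (translate g)) (cantor_standard_borel R) _ _ _ _).
- by move=> x; apply/funext => i; rewrite /precomp /= /translate invg1 mul1g enK.
- move=> g h x; apply/funext => i.
  by rewrite /precomp /= /translate rkK invgM mulgA.
- by move=> g; exact: measurable_precomp.
- move=> g A mA; apply: cantor_measure_precomp => //.
    by move=> i j /(can_inj rkK)/mulgI/(can_inj enK).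
  move=> s; apply: sign_prob_map => i j.
  by rewrite /K /translate !rkK pd_kernel_mull.
Defined.

Lemma sign_system_event : exists A : set sign_system,
  [/\ measurable A, mps_measure sign_system A = (1 / 2)%:E &
   forall h, h != 1%g ->
   mps_measure sign_system (A `&` mps_act h @^-1` A) =
   ((1 + (expR (Re (phi h) - Re (phi 1%g)) -
      expR (- Re (phi h) - Re (phi 1%g))) / 2) / 4)%:E].
Proof.
have muE s : uniq (map fst s) -> mps_measure sign_system (cyl s) = (q s)%:E.
  exact: cantor_measure_cyl.
exists (cyl [:: (rk 1%g, true)]); split; first exact: measurable_cyl.
  by rewrite muE// -(sign_prob1 K_psd (rk 1%g)).
move=> h h1; pose i := rk 1%g; pose c : set sign_system := cyl [:: (i, true)].
rewrite -/i -/c.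
(* The preimage constrains the coordinate of h^-1. It differs from that of 1 because h is not 1, so
   [q] gives the measure of the intersection. *)
have -> : c `&` mps_act h @^-1` c = cyl [:: (i, true); (translate h i, true)].
  by rewrite (cyl_cat [:: (i, true)] [:: (translate h i, true)]); congr setI.
rewrite muE; last first.
  rewrite /= andbT inE; apply: contra h1 => /eqP /(can_inj rkK).
  by rewrite rkK mulg1 => /esym/eqP; rewrite invg_eq1.
rewrite /q sign_prob2//; congr (_%:E).
rewrite /K /i /translate !rkK mulg1 /pd_kernel invgK mulg1 mulVg mulgV.
by have -> (x : R) : (x + x) / 2 = x by field.
Qed.

End sign_system.

(** * Autocorrelations *)

Definition norm2 (R : realType) (z : R[i]) : R := Re z ^+ 2 + Im z ^+ 2.

Lemma ReM (R : realType) (z w : R[i]) : Re (z * w) = Re z * Re w - Im z * Im w.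
Proof. by case: z w => a b [c d]. Qed.

Lemma ImM (R : realType) (z w : R[i]) : Im (z * w) = Re z * Im w + Im z * Re w.
Proof. by case: z w => a b [c d]. Qed.

Lemma Re_conj (R : realType) (z : R[i]) : Re (conj z) = Re z.
Proof. by case: z. Qed.

Lemma Im_conj (R : realType) (z : R[i]) : Im (conj z) = - Im z.
Proof. by case: z. Qed.

Lemma mulrconj_norm2 (R : realType) (z : R[i]) : z * conj z = (norm2 z)%:C.
Proof.
apply/eqP; rewrite eq_complex ReM ImM Re_conj Im_conj /norm2 /=.
by apply/andP; split; apply/eqP; ring.
Qed.

Section complex_integral.
Context (R : realType) (d : measure_display) (X : measurableType d).
Context (mu : probability X R).
Implicit Types (u v : X -> R) (f g : X -> R[i]).

Definition Rintegrable u := mu.-integrable setT (EFin \o u).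

Lemma Rintegrable_measurable u : Rintegrable u -> measurable_fun setT u.
Proof. by move/measurable_int/measurable_EFinP. Qed.

Lemma Rintegrable_cst c : Rintegrable (fun=> c).
Proof. exact: finite_measure_integrable_cst. Qed.

Lemma RintegrableD u v : Rintegrable u -> Rintegrable v ->
  Rintegrable (fun x => u x + v x).
Proof. by move=> iu iv; exact: (integrableD measurableT iu iv). Qed.

Lemma RintegrableZ c u : Rintegrable u -> Rintegrable (fun x => c * u x).
Proof. by move=> iu; exact: (integrableZl measurableT c iu). Qed.

Lemma Rintegrable_le u v : measurable_fun setT u -> Rintegrable v ->
  (forall x, `|u x| <= v x) -> Rintegrable u.
Proof.
move=> mu_ iv uv; apply: (le_integrable measurableT _ _ iv).
  exact/measurable_EFinP.
by move=> x _; rewrite /= lee_fin (le_trans (uv x))// ler_norm.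
Qed.

Definition Cintegrable f := Rintegrable (Re \o f) /\ Rintegrable (Im \o f).

Lemma CintegralD f g : Cintegrable f -> Cintegrable g ->
  Cintegrable (fun x => f x + g x) /\
  Cintegral mu (fun x => f x + g x) = Cintegral mu f + Cintegral mu g.
Proof.
move=> [rf jf] [rg jg]; split; first split.
- by have := RintegrableD rf rg; congr Rintegrable; apply/funext => x /=; rewrite raddfD.
- by have := RintegrableD jf jg; congr Rintegrable; apply/funext => x /=; rewrite raddfD.
rewrite /Cintegral.
under eq_Rintegral do rewrite raddfD /=.
under [X in _ +i* X]eq_Rintegral do rewrite raddfD /=.
by rewrite !RintegralD.
Qed.

Lemma CintegralZ c f : Cintegrable f ->
  Cintegrable (fun x => c * f x) /\
  Cintegral mu (fun x => c * f x) = c * Cintegral mu f.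
Proof.
move=> [rf jf].
have ReE x : Re (c * f x) = Re c * Re (f x) + (- Im c) * Im (f x) by rewrite ReM mulNr.
have ImE x : Im (c * f x) = Re c * Im (f x) + Im c * Re (f x) by rewrite ImM.
split; first split.
- have := RintegrableD (RintegrableZ (Re c) rf) (RintegrableZ (- Im c) jf).
  by congr Rintegrable; apply/funext => x; rewrite /= ReE.
- have := RintegrableD (RintegrableZ (Re c) jf) (RintegrableZ (Im c) rf).
  by congr Rintegrable; apply/funext => x; rewrite /= ImE.
rewrite /Cintegral.
under eq_Rintegral do rewrite ReE.
under [X in _ +i* X]eq_Rintegral do rewrite ImE.
rewrite !RintegralD ?RintegralZl//; try exact: RintegrableZ.
by apply/eqP; rewrite eq_complex ReM ImM /= mulNr !eqxx.
Qed.

Lemma Cintegral_cst c : Cintegral mu (fun=> c) = c.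
Proof.
have mu1 : fine (mu setT) = 1 by rewrite probability_setT.
by rewrite /Cintegral !Rintegral_cst// [fine _]mu1 !mulr1; case: c.
Qed.

Lemma Cintegrable_cst c : Cintegrable (fun=> c).
Proof. by split; exact: Rintegrable_cst. Qed.

Lemma Cintegral_sum (I : Type) (r : seq I) (h : I -> X -> R[i]) :
  (forall i, Cintegrable (h i)) ->
  Cintegrable (fun x => \sum_(i <- r) h i x) /\
  Cintegral mu (fun x => \sum_(i <- r) h i x) = \sum_(i <- r) Cintegral mu (h i).
Proof.
move=> ih; elim: r => [|i r [IH1 IH2]].
  under eq_fun do rewrite big_nil.
  by rewrite big_nil Cintegral_cst; split=> //; exact: Cintegrable_cst.
under eq_fun do rewrite big_cons.
by rewrite big_cons -IH2; exact: CintegralD.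
Qed.

Lemma Cintegral_ge0 f : (forall x, 0 <= f x) -> 0 <= Cintegral mu f.
Proof.
move=> f0; rewrite /Cintegral lecE /=.
have ReIm x : Im (f x) = 0 /\ 0 <= Re (f x).
  by have := f0 x; rewrite lecE /= => /andP[/eqP].
under eq_Rintegral do rewrite (proj1 (ReIm _)).
rewrite Rintegral_cst// mul0r eqxx /=.
by apply: Rintegral_ge0 => x _; have [] := ReIm x.
Qed.

Lemma Cintegral_conj f : Cintegrable f ->
  Cintegrable (fun x => conj (f x)) /\
  Cintegral mu (fun x => conj (f x)) = conj (Cintegral mu f).
Proof.
move=> [rf jf]; split; first split.
- by move: rf; congr Rintegrable; apply/funext => x; rewrite /= Re_conj.
- have := RintegrableZ (-1) jf.
  by congr Rintegrable; apply/funext => x; rewrite /= Im_conj mulN1r.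
rewrite /Cintegral.
under eq_Rintegral do rewrite Re_conj.
under [X in _ +i* X]eq_Rintegral do rewrite Im_conj -mulN1r.
by rewrite RintegralZl// mulN1r.
Qed.

Definition L2c f := [/\ measurable_fun setT (Re \o f),
  measurable_fun setT (Im \o f) & Rintegrable (@norm2 R \o f)].

Lemma L2cD f g : L2c f -> L2c g -> L2c (fun x => f x + g x).
Proof.
move=> [rf jf nf] [rg jg ng].
have mr : measurable_fun setT (Re \o (fun x => f x + g x)).
  have := measurable_funD rf rg; congr measurable_fun.
  by apply/funext => x /=; rewrite raddfD.
have mi : measurable_fun setT (Im \o (fun x => f x + g x)).
  have := measurable_funD jf jg; congr measurable_fun.
  by apply/funext => x /=; rewrite raddfD.
split=> //; apply: (Rintegrable_le _ (RintegrableZ 2 (RintegrableD nf ng))).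
  by apply: measurable_funD; exact: measurable_funX.
move=> x; rewrite /= /norm2 !raddfD /= ger0_norm ?addr_ge0 ?sqr_ge0//.
move: (Re (f x)) (Re (g x)) (Im (f x)) (Im (g x)) => a b c e.
have := sqr_ge0 (a - b); have := sqr_ge0 (c - e); nra.
Qed.

Lemma L2c_conj f : L2c f -> L2c (fun x => conj (f x)).
Proof.
move=> [rf jf nf]; split.
- by move: rf; congr measurable_fun; apply/funext => x; rewrite /= Re_conj.
- have := measurable_funN jf.
  by congr measurable_fun; apply/funext => x; rewrite /= Im_conj.
- move: nf; congr Rintegrable; apply/funext => x.
  by rewrite /= /norm2 Re_conj Im_conj sqrrN.
Qed.

Lemma L2c_cst c : L2c (fun=> c).
Proof.
by split; [exact: measurable_cst|exact: measurable_cst|exact: Rintegrable_cst].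
Qed.

(** Both parts of f g are bounded by |f|^2 + |g|^2; the squares supplied to [nra] give the
    inequalities between products and sums of squares. *)
Lemma L2cM f g : L2c f -> L2c g -> Cintegrable (fun x => f x * g x).
Proof.
move=> [rf jf nf] [rg jg ng]; split.
- apply: (Rintegrable_le _ (RintegrableD nf ng)) => [|x].
    have := measurable_funB (measurable_funM rf rg) (measurable_funM jf jg).
    by congr measurable_fun; apply/funext => x; rewrite /= ReM.
  rewrite /= ReM /norm2 ler_norml.
  move: (Re (f x)) (Re (g x)) (Im (f x)) (Im (g x)) => a b c e.
  have := sqr_ge0 (a - b); have := sqr_ge0 (c - e).
  have := sqr_ge0 (a + b); have := sqr_ge0 (c + e) => *; apply/andP; split; nra.
- apply: (Rintegrable_le _ (RintegrableD nf ng)) => [|x].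
    have := measurable_funD (measurable_funM rf jg) (measurable_funM jf rg).
    by congr measurable_fun; apply/funext => x; rewrite /= ImM.
  rewrite /= ImM /norm2 ler_norml.
  move: (Re (f x)) (Re (g x)) (Im (f x)) (Im (g x)) => a b c e.
  have := sqr_ge0 (a - e); have := sqr_ge0 (c - b).
  have := sqr_ge0 (a + e); have := sqr_ge0 (c + b) => *; apply/andP; split; nra.
Qed.

Lemma L2c_integrable f : L2c f -> Cintegrable f.
Proof.
move=> /L2cM/(_ (L2c_cst 1)); congr Cintegrable.
by apply/funext => x; rewrite mulr1.
Qed.

End complex_integral.

Section transport.
Context (R : realType) (d : measure_display) (X : measurableType d).
Context (mu : probability X R) (T : X -> X).
Hypothesis mT : measurable_fun setT T.
Hypothesis muT : forall A, measurable A -> mu (T @^-1` A) = mu A.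

Lemma eq_pushforward_integral (e : X -> \bar R) :
  (\int[pushforward mu T]_x e x = \int[mu]_x e x)%E.
Proof. by apply: eq_measure_integral => A mA _; exact: muT. Qed.

Lemma Rintegrable_comp (u : X -> R) : Rintegrable mu u -> Rintegrable mu (u \o T).
Proof.
move=> /integrableP[mu_ iu]; apply/integrableP; split.
  exact: (measurableT_comp mu_ mT).
move: iu; rewrite -eq_pushforward_integral ge0_integral_pushforward//.
exact: measurableT_comp.
Qed.

Lemma Rintegral_comp (u : X -> R) : Rintegrable mu u ->
  Rintegral mu setT (u \o T) = Rintegral mu setT u.
Proof.
move=> iu; have mu_ := measurable_int _ iu.
rewrite /Rintegral -(eq_pushforward_integral (EFin \o u)).
by rewrite (integral_pushforward mT mu_ (Rintegrable_comp iu)).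
Qed.

Lemma Cintegral_comp (f : X -> R[i]) : Cintegrable mu f ->
  Cintegral mu (f \o T) = Cintegral mu f.
Proof.
move=> [rf jf]; rewrite /Cintegral; congr Complex.
- exact: (Rintegral_comp rf).
- exact: (Rintegral_comp jf).
Qed.

Lemma L2c_comp (f : X -> R[i]) : L2c mu f -> L2c mu (f \o T).
Proof.
move=> [rf jf nf]; split.
- exact: (measurableT_comp rf mT).
- exact: (measurableT_comp jf mT).
- exact: (Rintegrable_comp nf).
Qed.

End transport.

Section autocorrelation.
Context (R : realType) (G : groupType) (X : mps R G).
Local Notation mu := (mps_measure X).

Lemma L2c_act (f : X -> R[i]) g : L2c mu f -> L2c mu (f \o mps_act g).
Proof.
by apply: L2c_comp; [exact: mps_act_measurable|exact: mps_act_preserving].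
Qed.

Definition autocorrelation (f : X -> R[i]) (g : G) : R[i] :=
  Cintegral mu (fun x => f (mps_act g x) * conj (f x)).

(** Invariance under [g] separates the two group elements: each now moves its own copy of [f], as in
    a Gram matrix. *)
Lemma autocorrelationE f g h : L2c mu f ->
  autocorrelation f (h^-1 * g)%g =
  Cintegral mu (fun x => f (mps_act h^-1%g x) * conj (f (mps_act g^-1%g x))).
Proof.
move=> f2; pose k x := f (mps_act h^-1%g x) * conj (f (mps_act g^-1%g x)).
have ik : Cintegrable mu k by apply: L2cM; [|apply: L2c_conj]; exact: L2c_act.
rewrite -[RHS](Cintegral_comp (mps_act_measurable g) (mps_act_preserving g) ik).
congr Cintegral; apply/funext => x.
by rewrite /k /= -!mps_actM mulVg mps_act1.
Qed.

Lemma autocorrelation_pd f : L2c mu f -> positive_definite (autocorrelation f).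
Proof.
move=> f2 n g c; pose F i x := f (mps_act (g i)^-1%g x).
have F2 i : L2c mu (F i) by exact: L2c_act.
have iF i j : Cintegrable mu (fun x => F j x * conj (F i x)).
  by apply: L2cM => //; exact: L2c_conj.
have -> : \sum_(i < n) \sum_(j < n) c i * conj (c j) *
      autocorrelation f ((g j)^-1 * g i)%g =
    Cintegral mu (fun x => \sum_(i < n) \sum_(j < n)
      c i * conj (c j) * (F j x * conj (F i x))).
  have ic i j := CintegralZ (c i * conj (c j)) (iF i j).
  rewrite (proj2 (Cintegral_sum _ _)) => [|i]; last first.
    exact: (proj1 (Cintegral_sum _ (fun j => proj1 (ic i j)))).
  apply: eq_bigr => i _.
  rewrite (proj2 (Cintegral_sum _ (fun j => proj1 (ic i j)))).
  by apply: eq_bigr => j _; rewrite (proj2 (ic i j)) autocorrelationE.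
apply: Cintegral_ge0 => x.
(* Pointwise, the double sum is the squared modulus of the sum of the conj (c i) * F i x. *)
rewrite (_ : \sum_i _ = (\sum_(j < n) conj (c j) * F j x) *
    conj (\sum_(i < n) conj (c i) * F i x)).
  exact: mul_conjC_ge0.
rewrite rmorph_sum /= mulr_sumr; apply: eq_bigr => i _.
rewrite mulr_suml; apply: eq_bigr => j _.
by rewrite rmorphM /= conjCK; ring.
Qed.

(** Since f and its translate both have integral m, each of the two cross terms contributes - |m|^2,
    and the constant term adds |m|^2 once. *)
Lemma autocorrelation_center f h : L2c mu f -> autocorrelation f h = 0 ->
  autocorrelation (fun x => f x + - Cintegral mu f) h =
  (- norm2 (Cintegral mu f))%:C.
Proof.
move=> f2 fh; set m := Cintegral mu f.
have if_ := L2c_integrable f2; have ic := Cintegral_conj if_.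
have it := L2c_integrable (L2c_act h f2).
have et : Cintegral mu (f \o mps_act h) = m.
  exact: (Cintegral_comp (mps_act_measurable h) (mps_act_preserving h) if_).
have ifh : Cintegrable mu (fun x => f (mps_act h x) * conj (f x)).
  by apply: L2cM; [exact: (L2c_act h f2)|exact: L2c_conj].
have [i1 e1] := CintegralZ (- m) (proj1 ic).
have [i2 e2] := CintegralZ (- conj m) it.
have [i3 e3] := CintegralD ifh i1.
have [i4 e4] := CintegralD i3 i2.
have [i5 e5] := CintegralD i4 (Cintegrable_cst mu (m * conj m)).
rewrite /autocorrelation.
rewrite (_ : (fun x => _) = (fun x => f (mps_act h x) * conj (f x)
  + - m * conj (f x) + - conj m * (f \o mps_act h) x + m * conj m)); last first.
  by apply/funext => x; rewrite rmorphD rmorphN /=; ring.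
rewrite e5 Cintegral_cst e4 e2 e3 e1 (proj2 ic) et -/m.
rewrite -/(autocorrelation f h) fh rmorphN /= -mulrconj_norm2.
by ring.
Qed.

End autocorrelation.

(** * Comparison of L^p conditions on a probability space *)

Section L2.
Context (R : realType) (d : measure_display) (X : measurableType d).
Context (mu : probability X R).

Lemma normc_sqr (z : R[i]) : Normc.normc z ^+ 2 = norm2 z.
Proof. by case: z => a b; rewrite /norm2 /= sqr_sqrtr// addr_ge0 ?sqr_ge0. Qed.

Lemma CLfun_L2c (p : \bar R) f : (2%:E <= p)%E -> CLfun mu p f -> L2c mu f.
Proof.
move=> p2 [rf jf nf]; split=> //.
have p1 : (1 <= p)%E by rewrite (le_trans _ p2)// lee_fin ler1n.
have mn : measurable_fun setT (fun x => Normc.normc (f x)).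
  rewrite (_ : (fun x => _) = (fun x => Num.sqrt (Re (f x) ^+ 2 + Im (f x) ^+ 2))).
    apply: (measurableT_comp (continuous_measurable_fun (@sqrt_continuous R))).
    by apply: measurable_funD; exact: measurable_funX.
  by apply/funext => x; case: (f x).
have Lp : (fun x => Normc.normc (f x)) \in Lfun mu p.
  by rewrite inE; apply/andP; rewrite !inE.
have mufin : mu setT \is a fin_num by exact: fin_num_measure.
have /Lfun2_integrable_sqr : (fun x => Normc.normc (f x)) \in Lfun mu 2%:E.
  by apply: (Lfun_subset _ p1 mufin p2 Lp); rewrite lee_fin ler1n.
by congr Rintegrable; apply/funext => x; rewrite /= normc_sqr.
Qed.

Lemma bounded_finite_norm (p : \bar R) (u : X -> R) (M : R) : (1 <= p)%E ->
  measurable_fun setT u -> (forall x, `|u x| <= M) -> finite_norm mu p u.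
Proof.
move=> p1 mu_ uM.
have mufin : mu setT \is a fin_num by exact: fin_num_measure.
have Loo : u \in Lfun mu +oo%E.
  rewrite inE; apply/andP; rewrite !inE; split=> //=.
  rewrite /finite_norm unlock; case: ifP => // _.
  rewrite (@le_lt_trans _ _ M%:E) ?ltry//; apply/ess_supP; apply: aeW => x /=.
  by rewrite lee_fin.
have := Lfun_subset p1 (leey 1) mufin (leey p) Loo.
by rewrite inE => /andP[_]; rewrite inE.
Qed.

Lemma Rintegrable_indic (A : set X) : measurable A -> Rintegrable mu (\1_A).
Proof. exact: integrable_indic. Qed.

Lemma Rintegral_indicE (A : set X) : measurable A ->
  Rintegral mu setT (\1_A : X -> R) = fine (mu A).
Proof. by move=> mA; rewrite /Rintegral integral_indic// setIT. Qed.

End L2.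

(** * The equivalence, by implications uniform in the exponent p *)

Lemma recurrent_of_no_pd (R : realType) (G : groupType) (p : \bar R) (H : set G) :
  (2%:E <= p)%E ->
  ~ (exists (phi : G -> R[i]) (r : R), [/\ positive_definite phi, r < 0 &
       forall h, H h -> phi h = r%:C]) ->
  recurrent_for p H.
Proof.
move=> p2 nophi X f fp fh; have f2 := CLfun_L2c p2 fp.
apply: contrapT => m0; apply: nophi.
exists (autocorrelation (fun x => f x + - Cintegral (mps_measure X) f)).
exists (- norm2 (Cintegral (mps_measure X) f)); split.
- by apply: autocorrelation_pd; apply: L2cD => //; exact: L2c_cst.
- rewrite oppr_lt0 lt0r addr_ge0 ?sqr_ge0// andbT paddr_eq0 ?sqr_ge0// !sqrf_eq0.
  apply/negP => /andP[/eqP re0 /eqP im0]; apply: m0; apply/eqP.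
  by rewrite eq_complex re0 im0 !eqxx.
- by move=> h Hh; apply: autocorrelation_center => //; exact: fh.
Qed.

Lemma event_not_recurrent (R : realType) (G : groupType) (p : \bar R) (H : set G)
    (X : mps R G) (A : set X) (rho : R) :
  (1 <= p)%E -> rho < 0 -> measurable A -> mps_measure X A = (1 / 2)%:E ->
  (forall h, H h ->
     mps_measure X (A `&` mps_act h @^-1` A) = ((1 + rho) / 4)%:E) ->
  ~ recurrent_for p H.
Proof.
move=> p1 rho0 mA muA muAh recH; set mu := mps_measure X.
pose c := Num.sqrt (- rho); have c2 : c ^+ 2 = - rho by rewrite sqr_sqrtr// oppr_ge0 ltW.
have c0 : c != 0 by rewrite sqrtr_eq0 -ltNge oppr_gt0.
(* The function 2 1_A - 1 is a sign of mean 0 with correlation [rho] along [H]. Adding [c] makes the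
   integral equal to [c] and the correlations equal to rho + c^2 = 0. *)
pose u (x : X) : R := 2 * \1_A x + (c - 1).
have iA := Rintegrable_indic mu mA.
have iu : Rintegrable mu u.
  by apply: RintegrableD; [exact: RintegrableZ|exact: Rintegrable_cst].
have mu_ : measurable_fun setT u by exact: Rintegrable_measurable iu.
have Cr (v : X -> R) : Cintegral mu (fun x => (v x)%:C) = (Rintegral mu setT v)%:C.
  by rewrite /Cintegral /= Rintegral_cst// mul0r.
have ecst k : Rintegral mu setT (fun=> k) = k.
  have mu1 : fine (mu setT) = 1 by rewrite /mu probability_setT.
  by rewrite Rintegral_cst// [fine _]mu1 mulr1.
have eA : Rintegral mu setT (\1_A : X -> R) = 1 / 2.
  exact: etrans (Rintegral_indicE mu mA) (congr1 fine muA).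
suff : Cintegral mu (fun x => (u x)%:C) = 0.
  rewrite Cr RintegralD//; [|exact: RintegrableZ|exact: Rintegrable_cst].
  rewrite RintegralZl// ecst eA => /eqP; rewrite eq_complex /= => /andP[/eqP h _].
  by case/eqP: c0; lra.
apply: recH => [|h Hh].
  split; [exact: mu_|exact: measurable_cst|].
  apply: (@bounded_finite_norm _ _ _ _ _ _ (2 + (`|c| + 1))) => //.
    rewrite (_ : (fun x => _) = fun x => `|u x|); first exact: measurableT_comp.
    by apply/funext => x /=; rewrite expr0n addr0 sqrtr_sqr.
  move=> x /=; rewrite expr0n addr0 sqrtr_sqr normr_id.
  rewrite (le_trans (ler_normD _ _))// lerD//.
    by rewrite indicE; case: (_ \in _); rewrite /= ?mulr1 ?mulr0 ?normr0 ?normr_nat.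
  by rewrite (le_trans (ler_normB _ _))// normr1.
have mAh : measurable (mps_act h @^-1` A).
  by rewrite -[X in measurable X]setTI; exact: mps_act_measurable.
have muAh' : mu (mps_act h @^-1` A) = (1 / 2)%:E by rewrite mps_act_preserving.
have uu x : (u (mps_act h x))%:C * conj (u x)%:C =
    (4 * \1_(A `&` mps_act h @^-1` A) x + (2 * (c - 1) * \1_(mps_act h @^-1` A) x +
     (2 * (c - 1) * \1_A x + (c - 1) ^+ 2)))%:C.
  have -> : conj (u x)%:C = (u x)%:C by apply/eqP; rewrite eq_complex /= oppr0 !eqxx.
  have hA : \1_(mps_act h @^-1` A) x = \1_A (mps_act h x) :> R by rewrite !indicE.
  by rewrite -rmorphM; congr (_%:C); rewrite /u indicI /= hA; ring.
under [fun x => _]funext do rewrite uu.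
have mI := measurableI _ _ mA mAh.
have iI := Rintegrable_indic mu mI; have iAh := Rintegrable_indic mu mAh.
rewrite Cr !RintegralD; try (by []);
  try (by do ?[exact: Rintegrable_cst|apply: RintegrableD|apply: RintegrableZ]).
have eI : Rintegral mu setT (\1_(A `&` mps_act h @^-1` A) : X -> R) = (1 + rho) / 4.
  exact: etrans (Rintegral_indicE mu mI) (congr1 fine (muAh h Hh)).
have eAh : Rintegral mu setT (\1_(mps_act h @^-1` A) : X -> R) = 1 / 2.
  exact: etrans (Rintegral_indicE mu mAh) (congr1 fine muAh').
rewrite ecst !RintegralZl// eI eAh eA; apply/eqP; rewrite eq_complex /= eqxx andbT.
by apply/eqP; field: c2.
Qed.

Lemma no_pd_of_recurrent (R : realType) (G : groupType) (p : \bar R)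
    (H : set G) : countable [set: G] -> infinite_set [set: G] -> (1 <= p)%E ->
  recurrent_for p H ->
  ~ (exists (phi : G -> R[i]) (r : R), [/\ positive_definite phi, r < 0 &
       forall h, H h -> phi h = r%:C]).
Proof.
move=> Gcountable Ginfinite p1 recH [phi [r [phi_pd r0 phiH]]].
have /card_set_bijP[rk] := eq_card_nat Gcountable Ginfinite.
rewrite setTT_bijective => -[en rkK enK].
have [A [mA muA muAh]] := sign_system_event phi_pd enK rkK.
have s0 : 0 <= Re (phi 1%g).
  by have := positive_definite_ge0 phi_pd; rewrite lecE => /andP[].
pose rho := (expR (r - Re (phi 1%g)) - expR (- r - Re (phi 1%g))) / 2.
have rho0 : rho < 0.
  by rewrite /rho pmulr_llt0 ?invr_gt0// subr_lt0 ltr_expR; lra.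
apply: (event_not_recurrent p1 rho0 mA muA) recH => h Hh.
rewrite muAh; first by rewrite (phiH h Hh).
(* The identity is not in [H], because phi(1) >= 0 > r. *)
apply/eqP => h1; move: s0; rewrite -h1 (phiH h Hh) /=; lra.
Qed.

Theorem theorem5p3 (R : realType) (G : groupType)
    (Gcountable : countable [set: G]) (Ginfinite : infinite_set [set: G])
    (H : set G) (Hnonempty : H !=set0) :
  [<-> (* (a) *) vdC_set R H;
       (* (b) *) operatorial_recurrence_set R H;
       (* (c) *) ~ (exists (phi : G -> R[i]) (r : R),
                     [/\ positive_definite phi, r < 0 &
                         forall h, H h -> phi h = r%:C])].
Proof.
have two_ge1 : (1 <= 2%:E :> \bar R)%E by rewrite lee_fin ler1n.
tfae.
(* The passage from bounded to square-integrable functions goes through (c): nonexistence of phi is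
   derived at p = +oo and used at p = 2. *)
- move=> vdC; apply: recurrent_of_no_pd => //.
  by apply: no_pd_of_recurrent vdC => //; exact: leey.
- by move=> opr; apply: no_pd_of_recurrent opr.
- by apply: recurrent_of_no_pd; exact: leey.
Qed.
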